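(* Let $C\subseteq\mathbb{R}^n$ be a (not necessarily convex) subset, let $f:C\to\mathbb{R}$ be an arbitrary function, and let $G:C\to\mathbb{R}^n$ be a Lipschitz mapping. Then there exists a convex function $F\in C^{1,1}(\mathbb{R}^n)$ with $F=f$ on $C$ and $\nabla F=G$ on $C$ if and only if there exists $\delta>0$ such that $$f(x)-f(y)-\langle G(y),x-y\rangle\ \geq\ \delta\,|G(x)-G(y)|^2\quad\text{for all }x,y\in C.$$
   Context: $C^{1,1}(\mathbb{R}^n)$ is the set of $C^1$ functions $F:\mathbb{R}^n\to\mathbb{R}$ (not required to be bounded) whose gradient is Lipschitz on $\mathbb{R}^n$. $|\cdot|$ is the Euclidean norm. *)

(* Defs.v *)
From HB Require Import structures.
From mathcomp Require Import all_boot all_order all_algebra.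
From mathcomp Require Import all_classical all_reals all_analysis.

Set Implicit Arguments.
Unset Strict Implicit.
Unset Printing Implicit Defensive.

Import Order.TTheory GRing.Theory Num.Theory.
Import numFieldNormedType.Exports.

Local Open Scope classical_set_scope.
Local Open Scope ring_scope.

Definition dotv (R : realType) (n : nat) (u v : 'rV[R]_n) : R :=
  \sum_(i < n) u 0 i * v 0 i.

(* The library norm `|u| on 'rV[R]_n is the sup norm, hence this definition.
   The two norms induce the same topology and the same differentials. *)
Definition enorm (R : realType) (n : nat) (u : 'rV[R]_n) : R :=
  Num.sqrt (dotv u u).

Definition elipschitz_on (R : realType) (n : nat) (A : set 'rV[R]_n)
    (g : 'rV[R]_n -> 'rV[R]_n) : Prop :=
  exists2 L : R, 0 <= L &
    forall x y, A x -> A y -> enorm (g x - g y) <= L * enorm (x - y).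

Definition gradient (R : realType) (n : nat) (F : 'rV[R]_n -> R)
    (x : 'rV[R]_n) : 'rV[R]_n :=
  \row_(i < n) 'D_(delta_mx 0 i) (F : 'rV[R]_n -> R^o) x.

Definition is_C1 (R : realType) (n : nat) (F : 'rV[R]_n -> R) : Prop :=
  (forall x, differentiable (F : 'rV[R]_n -> R^o) x) /\
  continuous (gradient F).

Definition is_C11 (R : realType) (n : nat) (F : 'rV[R]_n -> R) : Prop :=
  is_C1 F /\ elipschitz_on setT (gradient F).

(* Main.v *)
Require Import Defs.
From HB Require Import structures.
From mathcomp Require Import all_boot all_order all_algebra.
From mathcomp Require Import all_classical all_reals all_analysis.
From mathcomp Require Import ring lra.

Set Implicit Arguments.
Unset Strict Implicit.
Unset Printing Implicit Defensive.

Import Order.TTheory GRing.Theory Num.Theory.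
Import numFieldNormedType.Exports.

Local Open Scope classical_set_scope.
Local Open Scope ring_scope.

(* Put K = 1/(4 delta).  The affine functions
     z |-> f y + <G y, z - y> + delta |G y|^2   (y in C)
   have the tangents f y + <G y, x - y> as Moreau envelopes with parameter K.
   The extension F is the Moreau envelope of their supremum, so it is convex and
   lies above all the tangents; the hypothesis, read at z = y - 2 delta G y, says
   that F also lies below each parabola f y + <G y, x - y> + K |x - y|^2.
   Hence F = f and grad F = G on C.  An infimum of parabolas of curvature 2K that
   is convex has a two-sided quadratic expansion at every point, and such
   an F has a cocoercive, hence Lipschitz, gradient.  Cocoercivity of the gradient
   of a convex C^{1,1} function is also the converse implication. *)

(** * Euclidean inner product and its comparison with the sup norm *)

Section DotProduct.
Variables (R : realType) (n : nat).
Implicit Types u v w : 'rV[R]_n.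

Lemma dotvC u v : dotv u v = dotv v u.
Proof. by apply: eq_bigr => i _; rewrite mulrC. Qed.

Lemma dotvDr u v w : dotv u (v + w) = dotv u v + dotv u w.
Proof. by rewrite -big_split; apply: eq_bigr => i _; rewrite mxE mulrDr. Qed.

Lemma dotvZr a u v : dotv u (a *: v) = a * dotv u v.
Proof. by rewrite mulr_sumr; apply: eq_bigr => i _; rewrite mxE mulrCA. Qed.

Lemma dotvNr u v : dotv u (- v) = - dotv u v.
Proof. by rewrite -scaleN1r dotvZr mulN1r. Qed.

Lemma dotvDl u v w : dotv (u + v) w = dotv u w + dotv v w.
Proof. by rewrite dotvC dotvDr !(dotvC w). Qed.

Lemma dotvZl a u v : dotv (a *: u) v = a * dotv u v.
Proof. by rewrite dotvC dotvZr dotvC. Qed.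

Lemma dotvNl u v : dotv (- u) v = - dotv u v.
Proof. by rewrite dotvC dotvNr dotvC. Qed.

Definition dotvE := (dotvDl, dotvDr, dotvZl, dotvZr, dotvNl, dotvNr).

Lemma dotv_delta u i : dotv u (delta_mx 0 i) = u 0 i.
Proof.
rewrite /dotv (bigD1 i)//= big1 ?addr0 => [|j jNi].
  by rewrite !mxE !eqxx mulr1.
by rewrite !mxE (negbTE jNi) andbF mulr0.
Qed.

Lemma dotvv_ge0 u : 0 <= dotv u u.
Proof. by apply: sumr_ge0 => i _; rewrite -expr2 sqr_ge0. Qed.

Lemma sqr_coord_le u i : u 0 i ^+ 2 <= dotv u u.
Proof.
rewrite /dotv (bigD1 i)//= -expr2 lerDl.
by apply: sumr_ge0 => j _; rewrite -expr2 sqr_ge0.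
Qed.

Lemma enorm_ge0 u : 0 <= enorm u.
Proof. exact: sqrtr_ge0. Qed.

Lemma sqr_enorm u : enorm u ^+ 2 = dotv u u.
Proof. by rewrite sqr_sqrtr// dotvv_ge0. Qed.

(** Cauchy-Schwarz: [enorm v *: u - enorm u *: v] has nonnegative square. Cancelling
    [enorm u * enorm v] forces the zero vectors to be treated apart. *)
Lemma dotv_le_enorm u v : dotv u v <= enorm u * enorm v.
Proof.
have [u0|uN0] := eqVneq (enorm u) 0.
  have u_eq0 : u = 0.
    apply/rowP => i; rewrite mxE; apply/eqP; rewrite -sqrf_eq0 eq_le sqr_ge0.
    by rewrite (le_trans (sqr_coord_le u i))// -sqr_enorm u0 expr0n.
  by rewrite u_eq0 -[0](scale0r u) dotvZl mul0r mulr_ge0// enorm_ge0.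
have [v0|vN0] := eqVneq (enorm v) 0.
  have v_eq0 : v = 0.
    apply/rowP => i; rewrite mxE; apply/eqP; rewrite -sqrf_eq0 eq_le sqr_ge0.
    by rewrite (le_trans (sqr_coord_le v i))// -sqr_enorm v0 expr0n.
  by rewrite v_eq0 -[0](scale0r v) dotvZr mul0r mulr_ge0// enorm_ge0.
have uv_gt0 : 0 < enorm u * enorm v.
  by rewrite mulr_gt0// lt_neqAle eq_sym ?uN0 ?vN0 enorm_ge0.
have := dotvv_ge0 (enorm v *: u - enorm u *: v).
rewrite !dotvE (dotvC v u) -!sqr_enorm => ge0.
by rewrite -(ler_pM2l uv_gt0); lra.
Qed.

Lemma sqr_coord_le_normr u i : u 0 i ^+ 2 <= `|u| ^+ 2.
Proof.
rewrite -(real_normK (num_real (u 0 i))) lerXn2r ?nnegrE//.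
rewrite [leRHS]mx_normrE; apply/bigmax_geP; right => /=.
by exists (0, i).
Qed.

Lemma dotvv_le_normr u : dotv u u <= n%:R * `|u| ^+ 2.
Proof.
apply: (@le_trans _ _ (\sum_(i < n) `|u| ^+ 2)).
  by apply: ler_sum => i _; rewrite -expr2 sqr_coord_le_normr.
by rewrite sumr_const card_ord mulr_natl.
Qed.

Lemma normr_le_enorm u : `|u| <= enorm u.
Proof.
rewrite [leLHS]mx_normrE; apply/bigmax_leP; split => [|[i j] _] /=.
  exact: enorm_ge0.
rewrite (ord1 i) -ler_sqr ?nnegrE ?enorm_ge0//.
by rewrite real_normK ?num_real// sqr_enorm sqr_coord_le.
Qed.

Lemma enorm_le_normr u : enorm u <= Num.sqrt n%:R * `|u|.
Proof.
rewrite -ler_sqr ?nnegrE ?enorm_ge0 ?mulr_ge0 ?sqrtr_ge0//.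
by rewrite sqr_enorm exprMn sqr_sqrtr ?ler0n// dotvv_le_normr.
Qed.

Fact dotv_is_linear u : linear (dotv u : 'rV[R]_n -> R^o).
Proof. by move=> a v w; rewrite dotvDr dotvZr. Qed.

HB.instance Definition _ u := GRing.isLinear.Build R 'rV[R]_n R^o *:%R
  (dotv u : 'rV[R]_n -> R^o) (dotv_is_linear u).

Lemma dotv_continuous u : continuous (dotv u : 'rV[R]_n -> R^o).
Proof.
rewrite /dotv; apply: (@continuous_big R^o) => [|i _ v].
  exact: add_continuous.
by apply: continuousM; [exact: cst_continuous|exact: coord_continuous].
Qed.

End DotProduct.

(** * Gradients, and the tangent inequality for convex functions *)

Section Gradient.
Variables (R : realType) (n : nat).
Implicit Types (F : 'rV[R]_n -> R) (x y h p : 'rV[R]_n).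

(** A quadratic error is [o(h)], and uniqueness of the differential identifies it with [dotv p]. *)
Lemma gradient_quadratic F x p (K : R) :
    (forall h, `|F (x + h) - F x - dotv p h| <= K * dotv h h) ->
  differentiable (F : 'rV[R]_n -> R^o) x /\ gradient F x = p.
Proof.
move=> FK.
have Fo : (F \o shift x : 'rV[R]_n -> R^o) =
    cst (F x : R^o) + (dotv p : 'rV[R]_n -> R^o) +o_ (0 : 'rV[R]_n) id.
  apply/(@eqaddoP R 'rV[R]_n R^o 'rV[R]_n) => e e0.
  have c0 : 0 < `|K| * n%:R + 1 by rewrite ltr_wpDl ?mulr_ge0.
  have := @nbhs0_le R 'rV[R]_n _ (divr_gt0 e0 c0).
  apply: filterS => h; rewrite ler_pdivlMr// => le_h.
  rewrite !fctE/= opprD addrA [h + x]addrC (le_trans (FK h))//.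
  have := ler_wpM2l (normr_ge0 K) (dotvv_le_normr h).
  have := ler_wpM2r (dotvv_ge0 h) (ler_norm K).
  have := ler_wpM2r (normr_ge0 h) le_h.
  have := sqr_ge0 `|h|.
  lra.
have dF : 'd (F : 'rV[R]_n -> R^o) x = dotv p :> ('rV[R]_n -> R^o).
  by apply: diff_unique Fo; exact: dotv_continuous.
have Fdiff : differentiable (F : 'rV[R]_n -> R^o) x.
  by apply/diff_locallyP; rewrite dF; split; first exact: dotv_continuous.
split=> //; apply/rowP => i.
by rewrite mxE deriveE// dF dotv_delta.
Qed.

Lemma diff_gradient F x h : differentiable (F : 'rV[R]_n -> R^o) x ->
  'd (F : 'rV[R]_n -> R^o) x h = dotv (gradient F x) h.
Proof.
move=> dF; rewrite {1}(row_sum_delta h) linear_sum; apply: eq_bigr => i _.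
by rewrite linearZ mxE deriveE//= mulrC.
Qed.

Lemma convex_functionP F : convex_function setT F <->
  forall (t : R) x y, 0 <= t <= 1 ->
    F (t *: x + (1 - t) *: y) <= t * F x + (1 - t) * F y.
Proof.
split=> [cF t x y t01|cF t x y _ _]; last first.
  by apply: cF; rewrite ge0 le1.
have t01' : Itv.spec (@Itv.num_sem R) (Itv.Real `[0%Z, 1%Z]) t.
  by apply/andP; split; rewrite ?num_real// /= in_itv/=.
pose t' : {i01 R} := Itv.mk t01'.
exact: (cF t' x y (in_setT _) (in_setT _)).
Qed.

(** By convexity the difference quotients along [h] with step at most 1 are bounded by
    [F (x + h) - F x]; the step then tends to 0 from the right. *)
Lemma convex_gradient_le F x h :
    convex_function setT F -> differentiable (F : 'rV[R]_n -> R^o) x ->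
  F x + dotv (gradient F x) h <= F (x + h).
Proof.
move=> /convex_functionP cF dF; rewrite -diff_gradient// -deriveE//.
rewrite addrC -lerBrDr.
have dvF := @diff_derivable _ _ _ _ _ h dF.
have Fh := cvg_dnbhs_at_right dvF.
rewrite /derive -(cvg_lim _ Fh); last by [].
apply: limr_le; first by apply/cvg_ex; eexists; exact: Fh.
near=> t.
have t0 : 0 < t by near: t; exact: nbhs_right_gt.
have t1 : t <= 1 by near: t; apply: nbhs_right_le.
rewrite /= [_ *: _]mulrC ler_pdivrMr//.
have := cF t (x + h) x; rewrite ltW// t1 => /(_ isT).
rewrite scalerDr addrAC -scalerDl subrKC scale1r addrC.
lra.
Unshelve. all: by end_near. Qed.

End Gradient.

(** * Quadratic bounds, cocoercivity and Lipschitz gradients *)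

Section Smoothness.
Variables (R : realType) (n : nat).
Implicit Types (F : 'rV[R]_n -> R) (p : 'rV[R]_n -> 'rV[R]_n).
Implicit Types x y h : 'rV[R]_n.

(** The tangent at [y] and the parabola at [x] are compared at [x - 2 c d]; the step 2c = 1/(2K)
    minimizes the parabola minus the tangent along [d]. *)
Lemma cocoercive F p (K : R) : 0 < K ->
    (forall x h, F x + dotv (p x) h <= F (x + h)) ->
    (forall x h, F (x + h) <= F x + dotv (p x) h + K * dotv h h) ->
  forall x y, (4 * K)^-1 * enorm (p x - p y) ^+ 2
                <= F x - F y - dotv (p y) (x - y).
Proof.
move=> K0 Fl Fu x y; rewrite sqr_enorm.
set d := p x - p y; set c := (4 * K)^-1.
have dE : dotv (p x) d - dotv (p y) d = dotv d d.
  by rewrite /d !dotvE (dotvC (p y) (p x)); ring.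
have cK : K * c = 4^-1 by rewrite /c; field; rewrite gt_eqF.
clearbody d c.
have := Fl y (x - y + - (2 * c) *: d).
have := Fu x (- (2 * c) *: d).
rewrite addrA subrKC !dotvE.
have -> : K * (- (2 * c) * (- (2 * c) * dotv d d)) = c * dotv d d.
  by rewrite [LHS](_ : _ = 4 * (K * c) * c * dotv d d); [rewrite cK; field|ring].
have : c * (dotv (p x) d - dotv (p y) d) = c * dotv d d by rewrite dE.
lra.
Qed.

(** Adding the hypothesis for [x, y] and for [y, x] bounds |p x - p y|^2 by 2K <p x - p y, x - y>;
    Cauchy-Schwarz concludes. *)
Lemma cocoercive_lipschitz F p (K : R) : 0 < K ->
    (forall x y, (4 * K)^-1 * enorm (p x - p y) ^+ 2
                   <= F x - F y - dotv (p y) (x - y)) ->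
  elipschitz_on setT p.
Proof.
move=> K0 Fc; exists (2 * K); first by rewrite mulr_ge0// ltW.
move=> x y _ _.
have [d0|dN0] := eqVneq (enorm (p x - p y)) 0.
  by rewrite d0 !mulr_ge0// ?enorm_ge0// ltW.
have d0 : 0 < enorm (p x - p y) by rewrite lt_neqAle eq_sym dN0 enorm_ge0.
rewrite -(ler_pM2l d0) mulrCA -ler_pdivrMl ?mulr_gt0// -expr2.
have := dotv_le_enorm (p x - p y) (x - y).
have := Fc y x; have := Fc x y.
rewrite -(opprB (p x) (p y)) -(opprB x y) !sqr_enorm !dotvE.
rewrite !invfM (_ : 4^-1 = 2^-1 * 2^-1 :> R); last by field.
lra.
Qed.

(** The tangent at [x + h], read at [x], gives the bound with the gradient at [x + h]; moving that
    gradient to [x] costs at most L |h|^2. *)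
Lemma lipschitz_gradient_le F (L : R) : convex_function setT F ->
    (forall x, differentiable (F : 'rV[R]_n -> R^o) x) ->
    (forall x y, enorm (gradient F x - gradient F y) <= L * enorm (x - y)) ->
  forall x h, F (x + h) <= F x + dotv (gradient F x) h + L * dotv h h.
Proof.
move=> cF dF GL x h.
have := convex_gradient_le (- h) cF (dF (x + h)); rewrite addrK dotvNr.
have := dotv_le_enorm (gradient F (x + h) - gradient F x) h.
have := ler_wpM2r (enorm_ge0 h) (GL (x + h) x).
rewrite [x + h]addrC addrK -mulrA -expr2 sqr_enorm dotvDl dotvNl.
lra.
Qed.

Lemma elipschitz_continuous p : elipschitz_on setT p -> continuous p.
Proof.
move=> [L L0 pL] x; apply/(@cvgrPdist_le R 'rV[R]_n _ _ (nbhs_filter x)) => e e0.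
have c0 : 0 < L * Num.sqrt n%:R + 1 by rewrite ltr_wpDl ?mulr_ge0 ?sqrtr_ge0.
apply/(@nbhs_normP R 'rV[R]_n); exists (e / (L * Num.sqrt n%:R + 1)); first exact: divr_gt0.
move=> y /=; rewrite ltr_pdivlMr// => /ltW xy.
apply: (le_trans (normr_le_enorm _)); apply: (le_trans (pL _ _ I I)).
apply: le_trans (ler_wpM2l L0 (enorm_le_normr _)) (le_trans _ xy).
by rewrite mulrA mulrC ler_wpM2l// lerDl.
Qed.

Lemma C11_of_quadratic F (K : R) : 0 < K -> convex_function setT F ->
    (forall x, exists q : 'rV[R]_n,
       forall h, `|F (x + h) - F x - dotv q h| <= K * dotv h h) ->
  is_C11 F.
Proof.
move=> K0 cF Fq.
have dF x : differentiable (F : 'rV[R]_n -> R^o) x.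
  by have [q /gradient_quadratic[]] := Fq x.
have Gl : elipschitz_on setT (gradient F).
  apply: (@cocoercive_lipschitz F _ K) => //; apply: cocoercive => // x h.
    exact: convex_gradient_le.
  have [q Fxq] := Fq x; have [_ ->] := gradient_quadratic Fxq.
  by have := le_trans (ler_norm _) (Fxq h); lra.
by split=> //; split=> //; exact: elipschitz_continuous.
Qed.

(* The linear parts of two approximate upper parabolas at [x] are close to each
   other, so their coordinates, corrected by the errors, have a supremum. *)
Lemma quadratic_of_approx F (K : R) x : 0 < K -> convex_function setT F ->
    (forall e : R, 0 < e -> exists q : 'rV[R]_n,
       forall h, F (x + h) <= F x + e ^+ 2 + dotv q h + K * dotv h h) ->
  exists q : 'rV[R]_n,
    forall h, `|F (x + h) - F x - dotv q h| <= K * dotv h h.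
Proof.
move=> K0 /convex_functionP cF Fe.
pose P (q : 'rV[R]_n) (e : R) := 0 < e /\
  forall h, F (x + h) <= F x + e ^+ 2 + dotv q h + K * dotv h h.
have mid h : 2 * F x <= F (x + h) + F (x - h).
  have := cF 2^-1 (x + h) (x - h).
  rewrite (_ : 1 - 2^-1 = 2^-1 :> R); last by field.
  rewrite -scalerDr addrACA subrr addr0 -mulr2n -(scaler_nat 2 x) scalerA.
  rewrite mulVf// scale1r => /(_ _)/wrap[]; first by lra.
  lra.
pose a := Num.sqrt (8 * K).
have a0 : 0 <= a by exact: sqrtr_ge0.
have a2 : a ^+ 2 = 8 * K by rewrite sqr_sqrtr// mulr_ge0// ltW.
have close q1 e1 q2 e2 i : P q1 e1 -> P q2 e2 ->
    q1 0 i - q2 0 i <= a * (e1 + e2).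
  move=> [e1_gt0 Pq1] [e2_gt0 Pq2]; set d := q1 - q2.
  have dd : dotv d d <= 8 * K * (e1 ^+ 2 + e2 ^+ 2).
    have dE : dotv q1 d - dotv q2 d = dotv d d.
      by rewrite /d !dotvE (dotvC q2 q1); ring.
    (* The parabola of [q1] at -c d and that of [q2] at c d are averaged against [mid]. This [c]
       maximizes c - 2K c^2, whose maximal value 1/(8K) gives the constant in [dd]. *)
    clearbody d; pose c := (4 * K)^-1.
    have cK : K * c = 4^-1 by rewrite /c; field; rewrite gt_eqF.
    clearbody c; have := mid (- c *: d); have := Pq1 (- c *: d).
    have := Pq2 (- (- c *: d)).
    rewrite !dotvE.
    have e1E : K * (- c * (- c * dotv d d)) = (K * c) * (c * dotv d d) by ring.
    have e2E : K * - (- c * - (- c * dotv d d)) = (K * c) * (c * dotv d d).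
      by ring.
    rewrite e1E e2E cK => H1 H2 H3.
    have : c * (dotv q1 d - dotv q2 d) = c * dotv d d by rewrite dE.
    move=> H4.
    have : 2^-1 * c * dotv d d <= e1 ^+ 2 + e2 ^+ 2 by lra.
    have K8 : 0 < 8 * K by rewrite mulr_gt0.
    move=> /(ler_wpM2l (ltW K8)).
    by rewrite (_ : 8 * K * (2^-1 * c * dotv d d) = 4 * (K * c) * dotv d d);
      [rewrite cK divff// mul1r | field].
  have ae : 0 <= a * (e1 + e2) by rewrite mulr_ge0// addr_ge0// ltW.
  rewrite (le_trans (ler_norm _))// -ler_sqr ?nnegrE//.
  rewrite real_normK ?num_real//.
  have := sqr_coord_le d i; rewrite /d !mxE => /le_trans; apply.
  rewrite (le_trans dd)// exprMn a2 ler_wpM2l ?mulr_ge0 ?ltW//.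
  have := mulr_ge0 (ltW e1_gt0) (ltW e2_gt0); nra.
pose S i := [set r | exists q e, P q e /\ r = q 0 i - a * e].
pose q0 : 'rV[R]_n := \row_i sup (S i).
have q0P q e i : P q e -> `|q0 0 i - q 0 i| <= a * e.
  move=> Pq; rewrite mxE ler_distl; apply/andP; split.
    apply: ub_le_sup; last by exists q, e.
    exists (q 0 i + a * e) => _ [q' [e' [Pq' ->]]].
    by have := close _ _ _ _ i Pq' Pq; lra.
  apply: ge_sup; first by exists (q 0 i - a * e), q, e.
  move=> _ [q' [e' [Pq' ->]]].
  by have := close _ _ _ _ i Pq' Pq; lra.
clearbody q0; have upper h : F (x + h) <= F x + dotv q0 h + K * dotv h h.
  apply/ler_addgt0Pr => e e0.
  pose s := \sum_(i < n) `|h 0 i|.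
  have s0 : 0 <= s by apply: sumr_ge0.
  have c0 : 0 < 1 + a * s by rewrite ltr_wpDr// mulr_ge0.
  (* The cap at 1 gives t^2 <= t, so the total error t^2 + a t s stays below [e]. *)
  pose t := Num.min 1 (e / (1 + a * s)).
  have t0 : 0 < t by rewrite lt_min ltr01 divr_gt0.
  have t1 : t <= 1 by rewrite ge_min lexx.
  have te : t * (1 + a * s) <= e by rewrite -ler_pdivlMr// ge_min lexx orbT.
  have [q Fq] := Fe _ t0.
  have : dotv q h - dotv q0 h <= a * t * s.
    rewrite -dotvNl -dotvDl /dotv /s mulr_sumr; apply: ler_sum => i _.
    apply: (le_trans (ler_norm _)); rewrite normrM ler_wpM2r//.
    by rewrite !mxE distrC; apply: q0P.
  have := Fq h.
  have : t ^+ 2 <= t by rewrite expr2 ger_pMl.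
  lra.
exists q0 => h; rewrite ler_norml.
(* Midpoint convexity turns the upper bound at [- h] into the lower bound at [h]. *)
have := upper h; have := upper (- h); have := mid h.
rewrite dotvNr dotvNl dotvNr opprK => *.
by apply/andP; split; lra.
Qed.

End Smoothness.

(** * The Moreau envelope extending [f] *)

Section Extension.
Variables (R : realType) (n : nat) (C : set 'rV[R]_n).
Variables (f : 'rV[R]_n -> R) (G : 'rV[R]_n -> 'rV[R]_n) (delta : R).
Hypothesis delta_gt0 : 0 < delta.
Hypothesis fG : forall x y, C x -> C y ->
  delta * enorm (G x - G y) ^+ 2 <= f x - f y - dotv (G y) (x - y).
Hypothesis C_neq0 : C !=set0.
Implicit Types x y z h : 'rV[R]_n.

Let K := (4 * delta)^-1.

Let K_gt0 : 0 < K. Proof. by rewrite invr_gt0 mulr_gt0. Qed.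

Let deltaK : delta * K = 4^-1.
Proof. by rewrite /K; field; rewrite gt_eqF. Qed.

(* The epigraph of the supremum of the affine functions, which may be infinite;
   quantifying over its points [(z, t)] keeps all values real. *)
Definition shifted_epigraph (z : 'rV[R]_n) (t : R) := forall y, C y ->
  f y + dotv (G y) (z - y) + delta * dotv (G y) (G y) <= t.

Definition envelope_values x := [set r | exists z t, shifted_epigraph z t /\
  r = t + K * dotv (x - z) (x - z)].

Definition envelope x := inf (envelope_values x).

(** Completing the square: as 4 K delta = 1, the difference of the two sides is at least K |2 delta
    G y - (x - z)|^2. *)
Lemma tangent_le_values x y r : C y -> envelope_values x r ->
  f y + dotv (G y) (x - y) <= r.
Proof.
move=> Cy [z [t [/(_ y Cy) zt ->]]].
have := dotvv_ge0 ((2 * delta) *: G y - (x - z)).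
rewrite -(pmulr_rge0 _ K_gt0).
have -> : K * dotv ((2 * delta) *: G y - (x - z)) ((2 * delta) *: G y - (x - z))
    = delta * dotv (G y) (G y) - dotv (G y) (x - z)
      + K * dotv (x - z) (x - z).
  move: (x - z) (G y) => u v; rewrite !dotvE (dotvC u v).
  rewrite [LHS](_ : _ = 4 * (delta * K) * (delta * dotv v v)
    - 4 * (delta * K) * dotv v u + K * dotv u u); last by ring.
  by rewrite deltaK; field.
move: zt; rewrite !(dotvDr (G y)) !(dotvNr (G y)); lra.
Qed.

(** Expanding |G y - G w|^2 makes this a rearrangement of [fG] for the pair [y, w]. *)
Lemma contact_epigraph y : C y ->
  shifted_epigraph (y - (2 * delta) *: G y) (f y - delta * dotv (G y) (G y)).
Proof.
move=> Cy w Cw; have := fG Cy Cw.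
rewrite sqr_enorm !dotvE (dotvC (G y) (G w)); lra.
Qed.

(** At the contact point the square K |x - y + 2 delta G y|^2 produces the linear term and a delta
    |G y|^2 that cancels. *)
Lemma values_parabola x y : C y ->
  envelope_values x (f y + dotv (G y) (x - y) + K * dotv (x - y) (x - y)).
Proof.
move=> Cy; exists (y - (2 * delta) *: G y), (f y - delta * dotv (G y) (G y)).
split; first exact: contact_epigraph.
rewrite opprB addrCA addrC; move: (x - y) (G y) => u v.
rewrite !dotvE (dotvC u v).
rewrite [RHS](_ : _ = f y + 4 * (delta * K) * dotv v u + K * dotv u u
  + (4 * (delta * K) - 1) * delta * dotv v v); last by ring.
by rewrite deltaK; field.
Qed.

Lemma has_inf_values x : has_inf (envelope_values x).
Proof.
have [y Cy] := C_neq0; split; first by eexists; exact: values_parabola Cy.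
by exists (f y + dotv (G y) (x - y)) => r; exact: tangent_le_values.
Qed.

Lemma tangent_le_envelope x y : C y -> f y + dotv (G y) (x - y) <= envelope x.
Proof.
move=> Cy; apply: lb_le_inf; first exact: (has_inf_values x).1.
by move=> r; exact: tangent_le_values.
Qed.

Lemma envelope_le x z t : shifted_epigraph z t ->
  envelope x <= t + K * dotv (x - z) (x - z).
Proof. by move=> zt; apply: ge_inf; [exact: (has_inf_values x).2|exists z, t]. Qed.

Lemma envelope_le_parabola x y : C y ->
  envelope x <= f y + dotv (G y) (x - y) + K * dotv (x - y) (x - y).
Proof.
by move=> Cy; apply: ge_inf; [exact: (has_inf_values x).2|exact: values_parabola].
Qed.

Lemma envelope_near x (e : R) : 0 < e -> exists z t,
  shifted_epigraph z t /\ t + K * dotv (x - z) (x - z) <= envelope x + e.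
Proof.
move=> e0; have [_ [z [t [zt ->]]] zte] := inf_adherent e0 (has_inf_values x).
by exists z, t; split=> //; exact: ltW.
Qed.

(** Near-minimizers at [x] and [y] combine inside the epigraph, which is convex, and K |.|^2 is
    convex with defect [uv]. *)
Lemma convex_envelope : convex_function setT envelope.
Proof.
apply/convex_functionP => s x y /andP[s0 s1].
apply/ler_addgt0Pr => e e0.
have [z [t [zt xe]]] := envelope_near x e0.
have [w [r [wr ye]]] := envelope_near y e0.
have zwtr : shifted_epigraph (s *: z + (1 - s) *: w) (s * t + (1 - s) * r).
  move=> v Cv; have s1' : 0 <= 1 - s by rewrite subr_ge0.
  have := lerD (ler_wpM2l s0 (zt v Cv)) (ler_wpM2l s1' (wr v Cv)).
  rewrite !(dotvDr (G v)) !dotvNr !dotvZr; lra.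
apply: (le_trans (envelope_le _ zwtr)).
have -> : s *: x + (1 - s) *: y - (s *: z + (1 - s) *: w)
    = s *: (x - z) + (1 - s) *: (y - w).
  by rewrite !scalerBr opprD addrACA.
move: (x - z) (y - w) xe ye => u v xe ye.
have s1' : 0 <= 1 - s by rewrite subr_ge0.
have uv : 0 <= K * (s * (1 - s)) * dotv (u - v) (u - v).
  by rewrite !mulr_ge0 ?dotvv_ge0// ltW.
have := lerD (ler_wpM2l s0 xe) (ler_wpM2l s1' ye).
move: uv; rewrite !dotvE (dotvC v u); lra.
Qed.

(** A near-minimizer [z] at [x] remains a competitor at [x + h]; expanding K |x - z + h|^2 gives
    slope 2K(x - z) and curvature term K |h|^2. *)
Lemma C11_envelope : is_C11 envelope.
Proof.
apply: (C11_of_quadratic K_gt0 convex_envelope) => x.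
apply: (quadratic_of_approx K_gt0 convex_envelope) => e e0.
have [z [t [zt xe]]] := envelope_near x (exprn_gt0 2 e0).
exists ((2 * K) *: (x - z)) => h; apply: (le_trans (envelope_le _ zt)).
rewrite addrAC; move: (x - z) xe => u xe.
rewrite !dotvE (dotvC h u); lra.
Qed.

Lemma envelope_contact y : C y -> envelope y = f y.
Proof.
move=> Cy; apply/eqP; rewrite eq_le.
have := tangent_le_envelope y Cy; have := envelope_le_parabola y Cy.
by rewrite subrr -[0](scale0r 0) !dotvZr !mul0r mulr0 !addr0 => -> ->.
Qed.

(** The envelope is squeezed between a tangent and a parabola that touch at [y] with slope [G y]. *)
Lemma gradient_envelope y : C y -> gradient envelope y = G y.
Proof.
move=> Cy; apply: (@gradient_quadratic _ _ _ _ _ K _).2 => h.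
have := tangent_le_envelope (y + h) Cy; have := envelope_le_parabola (y + h) Cy.
rewrite (envelope_contact Cy) [y + h]addrC addrK => up low.
have := mulr_ge0 (ltW K_gt0) (dotvv_ge0 h).
by rewrite ler_norml => ?; apply/andP; split; lra.
Qed.

End Extension.

(* f and G are total functions; only their values on C are used. *)
Theorem corollary1p3 (R : realType) (n : nat) (C : set 'rV[R]_n)
    (f : 'rV[R]_n -> R) (G : 'rV[R]_n -> 'rV[R]_n)
    (G_lip : elipschitz_on C G) :
  (exists F : 'rV[R]_n -> R,
     [/\ convex_function setT F,
         is_C11 F,
         forall x, C x -> F x = f x
       & forall x, C x -> gradient F x = G x])
  <->
  (exists2 delta : R, 0 < delta &
     forall x y, C x -> C y ->
       f x - f y - dotv (G y) (x - y) >= delta * enorm (G x - G y) ^+ 2).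
Proof.
split=> [[F [cF [[dF _] [L L0 FL]] Ff FG]]|[delta delta0 fG]].
  (* [L] may be 0, while cocoercivity needs a positive constant. *)
  have K0 : 0 < L + 1 by rewrite ltr_wpDl.
  exists (4 * (L + 1))^-1; first by rewrite invr_gt0 mulr_gt0.
  move=> x y Cx Cy; rewrite -!Ff// -!FG//.
  apply: (cocoercive K0) => {x y Cx Cy} [x h|x h].
    exact: convex_gradient_le.
  apply: le_trans (lipschitz_gradient_le cF dF (fun x y => FL x y I I) x h) _.
  by rewrite lerD2l ler_wpM2r ?dotvv_ge0// lerDl.
(* For empty [C] the epigraph is everything and the envelope values are unbounded below, so the zero
   function is used instead. *)
have [->|C0] := eqVneq C set0.
  pose F0 : 'rV[R]_n -> R := cst 0.
  have c0 : convex_function setT F0.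
    by apply/convex_functionP => t x y _; rewrite !mulr0 addr0.
  exists F0; split=> //; apply: (C11_of_quadratic ltr01 c0) => x.
  exists 0 => h; rewrite -(scale0r 0) dotvZl mul0r !subr0 normr0.
  by rewrite mul1r dotvv_ge0.
have {}C0 : C !=set0 by apply/set0P.
exists (envelope C f G delta); split.
- exact: convex_envelope.
- exact: C11_envelope.
- exact: envelope_contact.
- exact: gradient_envelope.
Qed.
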